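(* (Parity Property for Nodal Curves) Let $C\subset\mathbb{A}^2$ be a nodal curve over $\mathbb{R}$ parametrized by $\alpha(t)$, and let $S\subset C$ be the set of nodes of $C$, where $|S|=n$. Suppose $\alpha^{-1}(S)=\{t_1,\dots,t_{2n}\}$, where $t_1<t_2<\cdots<t_{2n}$. If $\alpha^{-1}(P)=\{t_a,t_b\}$ for $P\in S$, then $a$ and $b$ are of opposite parity.
   Context: The ground field is $\mathbb{R}$, so $\mathbb{A}^1=\mathbb{R}$ and $\mathbb{A}^2=\mathbb{R}^2$. A curve $C\subset\mathbb{A}^2$ is a nodal curve if it admits a (polynomial) parametrization $\alpha:\mathbb{A}^1\to\mathbb{A}^2$ such that $\alpha'$ is non-vanishing and every singularity of $C$ is a node (an ordinary double point with two distinct tangent lines); ''parametrized by $\alpha(t)$'' refers to such a parametrization. *)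

(* Defs.v *)
From mathcomp Require Import all_boot all_order all_algebra.
From mathcomp Require Import classical_sets cardinality reals.
From mathcomp Require Import mpoly.

Set Implicit Arguments.
Unset Strict Implicit.
Unset Printing Implicit Defensive.

Import GRing.Theory.
Local Open Scope classical_set_scope.
Local Open Scope ring_scope.

Section PlaneCurves.
Variable R : realType.

(* Points of the affine plane and pairs of univariate polynomials are row
   vectors of length 2; P 0 : 'I_2 -> R is the coordinate function of P. *)
Definition vanishes_on (C : set 'rV[R]_2) (g : {mpoly R[2]}) : Prop :=
  forall P, C P -> g.@[P 0] = 0.

(* The degree k form of the Taylor expansion of g at P, in the local
   coordinates (x - P_0, y - P_1). *)
Definition taylor_form (k : nat) (g : {mpoly R[2]}) (P : 'rV[R]_2) :
    {mpoly R[2]} :=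
  pihomog mdeg k (g \mPo [tuple 'X_i + (P 0 i)%:MP | i < 2]).

(* If f generates the ideal I(C), then the lowest order at P of the elements
   of I(C) is the order of f, because the order of h * f is at least that of f.
   This is therefore the usual multiplicity, without a choice of f. *)
Definition multiplicity (C : set 'rV[R]_2) (P : 'rV[R]_2) (k : nat) : Prop :=
  (forall g, vanishes_on C g ->
     forall j, (j < k)%N -> taylor_form j g P = 0) /\
  (exists2 g, vanishes_on C g & taylor_form k g P != 0).

Definition singular_point (C : set 'rV[R]_2) (P : 'rV[R]_2) : Prop :=
  C P /\ ~ multiplicity C P 1.

(* When C has multiplicity k at P, the degree k forms at P of the elements of
   I(C) are the scalar multiples of the lowest form of a generator f, and the
   tangent lines are the linear factors of that form.  The line is given by its
   equation L, in coordinates centred at P. *)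
Definition tangent_line (C : set 'rV[R]_2) (P : 'rV[R]_2) (L : {mpoly R[2]}) :
    Prop :=
  [/\ L != 0, L \is 1.-homog &
      exists2 k, multiplicity C P k &
        forall g, vanishes_on C g -> exists h, taylor_form k g P = h * L].

Definition node (C : set 'rV[R]_2) (P : 'rV[R]_2) : Prop :=
  [/\ C P, multiplicity C P 2 &
      exists L1 L2, [/\ tangent_line C P L1, tangent_line C P L2 &
        forall c : R, L2 != c *: L1]].

Definition curve_point (alpha : 'rV[{poly R}]_2) (t : R) : 'rV[R]_2 :=
  map_mx (horner^~ t) alpha.

Definition velocity (alpha : 'rV[{poly R}]_2) (t : R) : 'rV[R]_2 :=
  curve_point (map_mx (@deriv R) alpha) t.

Definition nodal_parametrization (C : set 'rV[R]_2) (alpha : 'rV[{poly R}]_2) :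
    Prop :=
  [/\ C = range (curve_point alpha),
      forall t, velocity alpha t != 0 &
      forall P, singular_point C P -> node C P].

End PlaneCurves.

(* Main.v *)
Require Import Defs.
From mathcomp Require Import all_boot all_order all_algebra.
From mathcomp Require Import qfpoly.
From mathcomp Require Import classical_sets boolp cardinality reals.
From mathcomp Require Import ring lra mpoly.

(* Let f generate the ideal of C and let side(t) be the derivative of f at
   alpha(t) in the direction normal to alpha'(t).  It vanishes exactly over the
   nodes, where it has simple zeros, so the sign of side' alternates along
   t_1 < ... < t_2n, and it remains to see that two parameters a, b of one node
   have opposite signs of side'.

   Write X(s) - X(t) = F1 K and Y(s) - Y(t) = G1 K with K the greatest common
   divisor.  The relation f(alpha(s)) - f(alpha(t)) = 0 reads A F1 + B G1 = 0 for
   difference quotients A, B of f, so (A, B) = E (G1, - F1).  Differentiating this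
   at (a, b) in s and in t gives Hess(v, .) proportional to the rotation of
   v = alpha'(a), and Hess(w, .) to that of w = alpha'(b) with the opposite factor,
   provided that K(a, b) != 0.  To see the latter, note that K(r, s) = K(r, t)
   modulo K(s, t); hence K(., b) has at each of its real roots x the derivative
   K_s(x, x), which never vanishes since alpha is an immersion, so has constant
   sign, and a polynomial with that property has only one root.

   Three parameters over one node would have pairwise opposite signs, so every
   node has at most two parameters, hence exactly two, there being 2n in all. *)

Set Implicit Arguments.
Unset Strict Implicit.
Unset Printing Implicit Defensive.

Import Order.TTheory GRing.Theory Num.Theory.
Local Open Scope ring_scope.

(** * Simple real roots *)

Section RealRoots.
Variable R : rcfType.
Implicit Types p h : {poly R}.

Lemma root_factor p c : root p c ->
  exists2 h, p = h * ('X - c%:P) & p^`().[c] = h.[c].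
Proof.
move=> /factor_theorem [h ->]; exists h => //.
by rewrite derivM derivXsubC !hornerE subrr mulr0 add0r.
Qed.

(** A root where [h] decreases is divided out: the cofactor is negative there and still positive at
    [b], so induction on the degree finds a root further right. *)
Lemma root_upcrossing h (a b : R) : a < b -> h.[a] < 0 -> 0 < h.[b] ->
  exists c, [/\ a < c, c < b, root h c & 0 <= h^`().[c]].
Proof.
have [k] := ubnP (size h); elim: k => // k IHk in h a *.
move=> ltk ab ha hb.
have [|c /andP[]] := @poly_ivt _ h a b (ltW ab); first by rewrite !ltW.
rewrite !le_eqVlt => /predU1P[<-|ac].
  by move=> _; rewrite /root lt_eqF.
case/predU1P => [->|cb hc]; first by rewrite /root gt_eqF.
have [h1 hE h'c] := root_factor hc.
have [h1c|h1c] := leP 0 h1.[c]; first by exists c; rewrite h'c.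
have h1_neq0 : h1 != 0.
  by apply: contraTneq h1c => ->; rewrite horner0 ltxx.
have [|//|//||d [cd db hd h1d]] := IHk h1 c.
- by rewrite hE size_Mmonic ?monicXsubC ?size_XsubC // addn2 in ltk.
- by move: hb; rewrite hE hornerM !hornerE pmulr_lgt0 // subr_gt0.
exists d; split => //; first exact: lt_trans ac cd.
- by rewrite hE rootM hd.
rewrite hE derivM derivXsubC !hornerE (rootP hd) addr0.
by rewrite mulr_ge0 // subr_ge0 ltW.
Qed.

(** Writing p = (x - a)(x - b) h, the signs of p' at a and b say h(a) < 0 < h(b), and p' = (x - a)(x
    - b) h' at an upcrossing of h. *)
Lemma simple_roots_separated p (a b : R) : a < b -> root p a -> root p b ->
  0 < p^`().[a] -> 0 < p^`().[b] ->
  exists c, [/\ a < c, c < b, root p c & p^`().[c] <= 0].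
Proof.
move=> ab ra rb pa pb.
have [h1 pE] := root_factor ra; rewrite pE rootM in rb * => h1a.
have /root_factor [h hE h1b] : root h1 b.
  by move: rb; rewrite root_XsubC (gt_eqF ab) orbF.
have [||c [ac cb hc h'c]] := @root_upcrossing h a b ab.
- move: pa; rewrite pE h1a hE !hornerE.
  by rewrite nmulr_lgt0 // subr_lt0.
- move: pb; rewrite pE hE !derivM !derivXsubC !hornerE subrr !(mulr0, addr0, add0r).
  by rewrite pmulr_lgt0 // subr_gt0.
exists c; split => //; first by rewrite hE !rootM hc.
rewrite hE !derivM !derivXsubC !hornerE (rootP hc) !(mul0r, mulr0, addr0, add0r).
by rewrite pmulr_lle0 ?subr_gt0 // mulr_ge0_le0 // subr_le0 ltW.
Qed.

Lemma neq0_horner_same_sign p (a b : R) : (forall x, p.[x] != 0) ->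
  0 < p.[a] * p.[b].
Proof.
move=> p_neq0.
wlog ab : a b / a <= b.
  by move=> W; case: (leP a b) => [|/ltW] /W //; rewrite mulrC.
rewrite ltNge; apply/negP => pab.
have [c _ /rootP/eqP] : exists2 c, a <= c <= b & root p c.
  move: pab (p_neq0 a) (p_neq0 b).
  case: (ltrgt0P p.[a]) => // pa; case: (ltrgt0P p.[b]) => // pb pab _ _.
  - by move: pab; rewrite leNgt mulr_gt0.
  - have [|c ? ?] := @poly_ivt _ (- p) a b ab; last by exists c; rewrite // -rootN.
    by rewrite !hornerE oppr_le0 oppr_ge0 !ltW.
  - by apply: poly_ivt => //; rewrite !ltW.
  - by move: pab; rewrite leNgt nmulr_rgt0 ?pb.
by rewrite (negPf (p_neq0 c)).
Qed.

(** Equal signs at two consecutive roots would force a root in between, by [simple_roots_separated]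
    for [p] or [- p]. *)
Lemma alternating_simple_roots p m (t : 'I_m -> R) :
  (forall i j : 'I_m, (i < j)%N -> t i < t j) ->
  (forall x, root p x <-> exists i, x = t i) ->
  (forall i, p^`().[t i] != 0) ->
  forall i j : 'I_m, (0 < p^`().[t i] * p^`().[t j]) = (odd i == odd j).
Proof.
move=> t_incr rootsE simple.
have step (i j : 'I_m) : j = i.+1 :> nat -> p^`().[t i] * p^`().[t j] < 0.
  move=> ji.
  have noroot c : t i < c -> c < t j -> ~ root p c.
    move=> ic cj /rootsE [k ck]; rewrite ck in ic cj.
    have [ki|ik|/val_inj ki] := ltngtP k i.
    - by have := lt_trans ic (t_incr _ _ ki); rewrite ltxx.
    - have [kj|jk|/val_inj kj] := ltngtP k j.
      + by move: kj; rewrite ji ltnS leqNgt ik.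
      + by have := lt_trans (t_incr _ _ jk) cj; rewrite ltxx.
      + by rewrite kj ltxx in cj.
    - by rewrite ki ltxx in ic.
  have tij : t i < t j by apply: t_incr; rewrite ji.
  have ri k : root p (t k) by apply/rootsE; exists k.
  move: (simple i) (simple j).
  case: (ltrgt0P p^`().[t i]) => // pi _; case: (ltrgt0P p^`().[t j]) => // pj _.
  - have [c [ic cj rc _]] := simple_roots_separated tij (ri i) (ri j) pi pj.
    by case: (noroot c).
  - by rewrite pmulr_rlt0.
  - by rewrite nmulr_rlt0.
  - have [||||c [ic cj + _]] := @simple_roots_separated (- p) _ _ tij.
    + by rewrite rootN.
    + by rewrite rootN.
    + by rewrite derivN hornerN oppr_gt0.
    + by rewrite derivN hornerN oppr_gt0.
    + by rewrite rootN => rc; case: (noroot c).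
have mono (i j : 'I_m) : (i <= j)%N ->
    (0 < p^`().[t i] * p^`().[t j]) = (odd i == odd j).
  case: j => j ltj /=; elim: j => [|j IHj] in ltj *.
    rewrite leqn0 => /eqP i0; have -> : i = Ordinal ltj by apply: val_inj.
    by rewrite /= eqxx -expr2 exprn_even_gt0 ?simple.
  rewrite leq_eqVlt => /predU1P[ij|].
    have -> : i = Ordinal ltj by apply: val_inj.
    by rewrite /= eqxx -expr2 exprn_even_gt0 ?simple.
  rewrite ltnS => /(IHj (ltnW ltj)) {}IHj.
  have := step (Ordinal (ltnW ltj)) (Ordinal ltj) erefl.
  have -> : (odd i == odd j.+1) = ~~ (odd i == odd j).
    by rewrite /=; case: (odd i); case: (odd j).
  rewrite -IHj; move: (simple i) (simple (Ordinal (ltnW ltj))).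
  set x := _.[t i]; set y := _.[_]; set z := _.[_] => x0 y0 yz.
  case: (ltrgt0P x) x0 => // x0 _; case: (ltrgt0P y) y0 yz => // y0 _ yz.
  - by move: yz; rewrite pmulr_rlt0 // !(pmulr_rgt0 _ x0) y0 => z0; rewrite lt_gtF.
  - by move: yz; rewrite nmulr_rlt0 // !(pmulr_rgt0 _ x0) => ->; rewrite lt_gtF.
  - by move: yz; rewrite pmulr_rlt0 // !(nmulr_rgt0 _ x0) => ->; rewrite lt_gtF.
  - by move: yz; rewrite nmulr_rlt0 // !(nmulr_rgt0 _ x0) y0 => z0; rewrite lt_gtF.
move=> i j; case: (leqP i j) => [/mono //|/ltnW/mono].
by rewrite mulrC eq_sym.
Qed.

End RealRoots.

(** * Gauss's lemma and saturated ideals *)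

Section Gauss.
Variable F : fieldType.
Implicit Types (c p : {poly F}) (f g q : {poly {poly F}}).

(** Gauss's lemma: the quotient of [{poly F}] by [p] is a field, so the polynomials over it form a
    domain, in which the reduction of q f is zero. *)
Lemma monic_irreducible_dvd_coefM p q f : monic_irreducible_poly p ->
  (forall i, p %| (q * f)`_i) ->
  (forall i, p %| q`_i) \/ (forall i, p %| f`_i).
Proof.
move=> p_mi dvdqf.
pose phi c : {poly %/ p with p_mi} := in_qpoly p c.
have phi0 c : (phi c == 0) = (p %| c).
  apply/eqP/idP => [/val_eqP /=|dvdpc]; last apply/val_eqP => /=.
    by rewrite -Pdiv.IdomainMonic.modpE ?mk_monicE // p_mi.
  by rewrite -Pdiv.IdomainMonic.modpE ?mk_monicE // p_mi.
have [Phi PhiE] : exists Phi : {rmorphism {poly {poly F}} -> {poly {poly %/ p with p_mi}}},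
    forall g i, (Phi g)`_i = phi g`_i.
  by exists (map_poly (in_qpoly p)) => g i; rewrite coef_map.
have Phi0 g : Phi g = 0 -> forall i, p %| g`_i.
  by move=> /polyP Phig i; rewrite -phi0 -PhiE Phig coef0.
have /eqP : Phi (q * f) = 0.
  by apply/polyP => i; rewrite PhiE coef0; apply/eqP; rewrite phi0.
rewrite rmorphM mulf_eq0 => /orP[] /eqP; [left|right]; exact: Phi0.
Qed.

Lemma dvd_coef_factor p q :
  (forall i, p %| q`_i) -> exists h, q = p%:P * h.
Proof.
move=> pq; exists (map_poly (fun c => c %/ p) q); apply/polyP => i.
by rewrite coefCM coef_map_id0 ?div0p // mulrC divpK.
Qed.

Lemma monic_irreducible_factor c : (1 < size c)%N ->
  exists2 p, monic_irreducible_poly p & p %| c.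
Proof.
have [k] := ubnP (size c); elim: k => // k IHk in c * => ltck c_gt1.
have c_neq0 : c != 0 by rewrite -size_poly_gt0 ltnW.
have [c_irr|not_irr] := pselect (irreducible_poly c).
  exists ((lead_coef c)^-1 *: c); last by rewrite dvdpZl ?invr_eq0 ?lead_coef_eq0.
  have c_eqp : (lead_coef c)^-1 *: c %= c by rewrite eqp_scale ?invr_eq0 ?lead_coef_eq0.
  split; last by rewrite monicE lead_coefZ mulVf ?lead_coef_eq0.
  split=> [|q q_neq1]; first by rewrite (eqp_size c_eqp).
  by rewrite (eqp_dvdr _ c_eqp) (eqp_rtrans c_eqp); apply: c_irr.
have [q [q_neq1 qc q_neqp]] : exists q : {poly F}, [/\ size q != 1, q %| c & ~~ (q %= c)].
  apply: contra_notP not_irr => no_q; split=> // q q_neq1 qc.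
  by apply: contra_notT no_q => q_neqp; exists q.
have ltqc : (size q < size c)%N.
  by rewrite ltn_neqAle dvdp_leq // andbT dvdp_size_eqp.
have q_gt1 : (1 < size q)%N.
  have : q != 0 by apply: contraNneq c_neq0 => q0; rewrite q0 dvd0p in qc.
  by rewrite -size_poly_gt0; case: (size q) q_neq1 => [|[]].
have [p p_mi pq] := IHk q (leq_trans ltqc ltck) q_gt1.
by exists p => //; apply: dvdp_trans qc.
Qed.

Definition primitive f :=
  forall p, monic_irreducible_poly p -> ~ forall i, p %| f`_i.

(** The irreducible factors of [c] are cancelled one at a time: each divides [q] by Gauss's lemma,
    as it cannot divide [f]. *)
Lemma primitive_dvd f c g q : primitive f -> c != 0 -> c%:P * g = q * f ->
  exists h, g = h * f.
Proof.
move=> f_prim; have [k] := ubnP (size c).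
elim: k => // k IHk in c q * => ltck c_neq0 cg.
have [c_le1|c_gt1] := leqP (size c) 1.
  have [d cE] : exists d, c = d%:P by exists c`_0; apply: size1_polyC.
  exists (d^-1%:P%:P * q); rewrite -mulrA -cg cE mulrA -!polyCM mulVf ?mul1r //.
  by rewrite cE polyC_eq0 in c_neq0.
have [p p_mi pc] := monic_irreducible_factor c_gt1.
have [p_gt1 p_mon] : (1 < size p)%N /\ p \is monic by split; apply p_mi.
have [d cE] : exists d, c = d * p by exists (c %/ p); rewrite divpK.
have [q' qE] : exists q', q = p%:P * q'.
  apply: dvd_coef_factor; have [i|//|/f_prim//] := @monic_irreducible_dvd_coefM p q f p_mi.
  by rewrite -cg coefCM dvdp_mulr.
have [d_neq0 p_neq0] : d != 0 /\ p != 0.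
  by apply/andP; rewrite -negb_or -mulf_eq0 -cE.
apply: (IHk d q' _ d_neq0).
  rewrite ltnS in ltck; apply: leq_trans ltck; rewrite cE size_mul //.
  by case: (size p) p_gt1 => [|[|m]] // _; rewrite !addnS /= ltnS leq_addr.
apply: (@mulfI _ p%:P); first by rewrite polyC_eq0.
by rewrite mulrA -polyCM mulrC [p * d]mulrC -cE mulrC cg qE mulrA.
Qed.

Lemma unit_lead_coef_primitive f (a : F) : a != 0 -> lead_coef f = a%:P ->
  primitive f.
Proof.
move=> a_neq0 fa p p_mi /(_ (size f).-1).
rewrite -lead_coefE fa => /dvdp_leq; rewrite polyC_eq0 => /(_ a_neq0).
by rewrite size_polyC a_neq0 leqNgt p_mi.
Qed.

(** Once the nonzero elements of [{poly F}] are inverted, the ideal is principal. Saturation allows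
    a primitive generator, and primitivity clears the denominators. *)
Lemma saturated_ideal_principal (J : {poly {poly F}} -> Prop) g0 :
  (forall g h, J g -> J h -> J (g - h)) -> (forall g h, J g -> J (h * g)) ->
  (forall c g, c != 0 -> J (c%:P * g) -> J g) -> J g0 -> g0 != 0 ->
  exists2 f, J f & forall g, J g -> exists h, g = h * f.
Proof.
move=> JB JM Jsat Jg0 g0_neq0.
pose ysize n := `[< exists f, [/\ J f, f != 0 & size f = n] >].
have ex_ysize : exists n, ysize n by exists (size g0); apply/asboolP; exists g0.
have [n /asboolP[f1 [Jf1 f1_neq0 f1n]] n_min] := ex_minnP ex_ysize.
(* Among the elements of least degree, one whose leading coefficient has least degree is primitive:
   a common prime factor could be removed within [J] by saturation. *)
pose xsize m := `[< exists f, [/\ J f, size f = n & size (lead_coef f) = m] >].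
have ex_xsize : exists m, xsize m.
  by exists (size (lead_coef f1)); apply/asboolP; exists f1.
have [m /asboolP[f [Jf fn fm]] m_min] := ex_minnP ex_xsize.
have f_neq0 : f != 0 by rewrite -size_poly_gt0 fn -f1n size_poly_gt0.
have f_prim : primitive f.
  move=> p p_mi /dvd_coef_factor [h fE].
  have p_gt1 : (1 < size p)%N by apply p_mi.
  have p_neq0 : p != 0 by rewrite -size_poly_gt0 ltnW.
  have h_neq0 : h != 0 by apply: contraNneq f_neq0 => h0; rewrite fE h0 mulr0.
  have /m_min : xsize (size (lead_coef h)).
    apply/asboolP; exists h; split => //.
      by apply: Jsat p_neq0 _; rewrite -fE.
    by rewrite -fn fE mul_polyC size_scale.
  rewrite -fm fE lead_coefM lead_coefC size_mul ?lead_coef_eq0 // leqNgt.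
  by case: (size p) p_gt1 => [|[|k]] // _; rewrite !addSn /= ltnS leq_addl.
exists f => // g Jg.
(* Pseudo-division by [f], with [c] a power of its leading coefficient; the remainder lies in [J]
   and has too small a degree to be nonzero. *)
have := Pdiv.Idomain.divp_eq g f.
set c := _ ^+ _; set q := Pdiv.Field.divp _ _; set r' := Pdiv.Field.modp _ _ => cg.
have r0 : r' = 0.
  apply/eqP; apply: contraT => r_neq0.
  have /n_min : ysize (size r').
    apply/asboolP; exists r'; split => //.
    have -> : r' = c%:P * g - q * f by rewrite mul_polyC cg addrC addKr.
    by apply: JB; apply: JM.
  by rewrite leqNgt -fn Pdiv.Idomain.ltn_modpN0.
apply: (@primitive_dvd f c g q) => //; last by rewrite mul_polyC cg r0 addr0.
by rewrite expf_neq0 // lead_coef_eq0.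
Qed.

End Gauss.

(** * Taylor forms *)

Lemma mpoly_ring_ind n (S : comNzRingType) (Q : {mpoly S[n]} -> Prop) :
  (forall c, Q c%:MP) -> (forall i, Q 'X_i) ->
  (forall p q, Q p -> Q q -> Q (p + q)) ->
  (forall p q, Q p -> Q q -> Q (p * q)) -> forall p, Q p.
Proof.
move=> QC QX QD QM; elim/mpolyind => [|c m p _ _ Qp]; first exact: QC 0.
apply: (QD) => //; rewrite -mul_mpolyC; apply: (QM) => //.
rewrite mpolyXE_id; apply: (big_ind Q (QC 1) QM) => i _.
elim: (m i) => [|k IHk]; first exact: QC 1.
by rewrite exprS; apply: (QM).
Qed.

Lemma mderivXU n (S : nzRingType) (i j : 'I_n) :
  ('X_i : {mpoly S[n]})^`M(j) = (i == j)%:R%:MP.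
Proof.
rewrite mderivX mnm1E; case: eqP => [->|_]; last by rewrite scale0r.
by rewrite -{1}[U_(j)%MM]add0m addmK mpolyX0 scale1r.
Qed.

Section Substitution.
Variables (R : comNzRingType) (n : nat).
Implicit Types (g : {mpoly R[n]}) (beta : 'I_n -> {poly R}).

Definition along beta g : {poly R} := mmap polyC beta g.

Lemma horner_along beta g x : (along beta g).[x] = g.@[fun i => (beta i).[x]].
Proof.
elim/mpoly_ring_ind: g => [c|i|p q|p q]; rewrite /along.
- by rewrite mmapC mevalC hornerC.
- by rewrite mmapX mevalXU mmap1U.
- by rewrite mmapD mevalD hornerD => -> ->.
- by rewrite rmorphM /= mevalM hornerM => -> ->.
Qed.

Lemma deriv_along beta g :
  (along beta g)^`() = \sum_i along beta g^`M(i) * (beta i)^`().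
Proof.
elim/mpoly_ring_ind: g => [c|i|p q|p q]; rewrite /along.
- rewrite mmapC derivC big1 // => i _.
  by rewrite mderivC mmap0 mul0r.
- rewrite mmapX mmap1U (bigD1 i) //= big1 ?addr0 => [|j /negPf ji].
    by rewrite mderivXU eqxx rmorph1 mul1r.
  by rewrite mderivXU eq_sym ji mmap0 mul0r.
- move=> pE qE; rewrite mmapD derivD pE qE -big_split /=.
  by apply: eq_bigr => i _; rewrite mderivD mmapD mulrDl.
- move=> pE qE; rewrite rmorphM derivM pE qE mulr_sumr mulr_suml -big_split /=.
  by apply: eq_bigr => i _; rewrite mderivM mmapD !rmorphM /=; ring.
Qed.

End Substitution.

Section TaylorForms.
Variable R : realType.
Implicit Types (g : {mpoly R[2]}) (P : 'rV[R]_2) (u : 'I_2 -> R).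

(** Along the ray t u a monomial of degree d becomes a multiple of t^d, so the coefficient of t^k
    comes from the degree k part. *)
Lemma coef_along_ray g u k :
  (along (fun i => u i *: 'X) g)`_k = (pihomog mdeg k g).@[u].
Proof.
rewrite /along; elim/mpolyind: g => [|c m p _ _ pE].
  by rewrite mmap0 pihomog0 meval0 coef0.
rewrite mmapD pihomogD mevalD coefD pE mmapZ coefCM linearZ /= mevalZ.
congr (c * _ + _); rewrite mmapX pihomogX /mmap1.
under eq_bigr do rewrite exprZn.
rewrite scaler_prod prodrXr -mdegE coefZ coefXn eq_sym.
by case: eqP => _; rewrite ?meval0 ?mulr0 // mulr1 mevalX.
Qed.

Lemma meval_taylor_form k g P u :
  (taylor_form k g P).@[u] = (along (fun i => (P 0 i)%:P + u i *: 'X) g)`_k.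
Proof.
rewrite /taylor_form -coef_along_ray.
apply: (congr1 (fun p : {poly R} => p`_k)).
rewrite /along; elim/mpoly_ring_ind: g => [c|i|p q|p q].
- by rewrite comp_mpolyC !mmapC.
- rewrite comp_mpolyXU -tnth_nth tnth_mktuple mmapX mmap1U.
  by rewrite mmapD mmapX mmapC mmap1U addrC.
- by rewrite comp_mpolyD !mmapD => -> ->.
- by rewrite !rmorphM /= => -> ->.
Qed.

Lemma deriv_affine (a b : R) : (a%:P + b *: 'X)^`() = b%:P.
Proof. by rewrite derivD derivC derivZ derivX add0r alg_polyC. Qed.

Lemma meval_taylor_form1 g P u :
  (taylor_form 1 g P).@[u] = \sum_i u i * g^`M(i).@[P 0].
Proof.
rewrite meval_taylor_form; set p := along _ _.
have -> : p`_1 = p^`().[0] by rewrite horner_coef0 coef_deriv mulr1n.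
rewrite deriv_along horner_sum; apply: eq_bigr => i _.
rewrite deriv_affine hornerM hornerC mulrC horner_along; congr (_ * _).
by apply: meval_eq => j; rewrite !hornerE.
Qed.

Lemma meval_taylor_form2 g P u :
  (taylor_form 2 g P).@[u] *+ 2 =
  \sum_i \sum_j u i * u j * g^`M(i)^`M(j).@[P 0].
Proof.
rewrite meval_taylor_form; set p := along _ _.
have -> : p`_2 *+ 2 = p^`()^`().[0] by rewrite horner_coef0 !coef_deriv mulr1n.
rewrite deriv_along raddf_sum horner_sum; apply: eq_bigr => i _.
rewrite deriv_affine /= derivM derivC mulr0 addr0 deriv_along mulr_suml horner_sum.
apply: eq_bigr => j _.
rewrite deriv_affine !hornerM !hornerC horner_along -mulrA mulrC [u j * _]mulrC.
congr (_ * _).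
by apply: meval_eq => l; rewrite !hornerE.
Qed.

End TaylorForms.

(** * Bivariate polynomials as iterated univariate ones *)

Section BivariatePolynomials.
Variable R : realType.
Implicit Types (g : {mpoly R[2]}) (h : {poly {poly R}}).

(** The inner variable becomes x and the outer one y, so that the constants [c%:P] are the
    polynomials in x alone. *)
Definition to_mpoly : {rmorphism {poly {poly R}} -> {mpoly R[2]}} :=
  horner_eval 'X_1 \o map_poly (horner_eval 'X_0 \o map_poly (@mpolyC 2 R)).

Lemma to_mpolyC (c : {poly R}) : to_mpoly c%:P = (map_poly (@mpolyC 2 R) c).['X_0].
Proof. by rewrite /= map_polyC /horner_eval hornerC. Qed.

Lemma to_mpoly_surj g : exists h, to_mpoly h = g.
Proof.
elim/mpoly_ring_ind: g => [c|i|_ _ [p <-] [q <-]|_ _ [p <-] [q <-]].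
- by exists c%:P%:P; rewrite to_mpolyC map_polyC hornerC.
- case: (unliftP ord0 i) => [j ->|->].
    exists 'X; rewrite /= map_polyX /horner_eval hornerX.
    by congr ('X_ _); apply: val_inj; rewrite /= ord1.
  by exists 'X%:P; rewrite to_mpolyC map_polyX hornerX.
- by exists (p + q); rewrite rmorphD.
- by exists (p * q); rewrite rmorphM.
Qed.

Lemma meval_to_mpoly h u : (to_mpoly h).@[u] = h.[(u 1)%:P].[u 0].
Proof.
elim/poly_ind: h => [|h c hE]; first by rewrite rmorph0 meval0 !horner0.
rewrite rmorphD rmorphM mevalD mevalM hE !hornerE to_mpolyC; congr (_ * _ + _).
  by rewrite /= map_polyX /horner_eval hornerX mevalXU.
elim/poly_ind: c => [|c d cE]; first by rewrite rmorph0 !horner0 meval0.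
rewrite rmorphD rmorphM /= map_polyX map_polyC !hornerE mevalD mevalM mevalC cE.
by rewrite mevalXU.
Qed.

Lemma poly_eval_eq0 (p : {poly R}) : (forall x, p.[x] = 0) -> p = 0.
Proof.
move=> p0; apply/eqP; apply: contraT => p_neq0.
have := max_poly_roots p_neq0 (rs := [seq i%:R | i <- iota 0 (size p)]).
rewrite size_map size_iota ltnn; apply.
  by apply/allP => x _; apply/rootP.
by rewrite map_inj_uniq ?iota_uniq // => i j /eqP; rewrite eqr_nat => /eqP.
Qed.

Lemma mpoly_eval_eq0 g : (forall u, g.@[u] = 0) -> g = 0.
Proof.
have [h <-] := to_mpoly_surj g => h0.
suff -> : h = 0 by rewrite rmorph0.
apply/polyP => i; rewrite coef0; apply: poly_eval_eq0 => a.
suff : map_poly (horner_eval a) h = 0.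
  by move=> /polyP/(_ i); rewrite coef_map coef0.
apply: poly_eval_eq0 => b.
have := h0 (fun i => if i == 0 then a else b).
rewrite meval_to_mpoly /= => <-.
by rewrite -[b in LHS](hornerC b a) -[b%:P.[a]]/(horner_eval a b%:P) horner_map.
Qed.

End BivariatePolynomials.

(** * Common factor of the increments *)

Section TwoParameters.
Variable F : fieldType.
Implicit Types (p : {poly F}) (h : {poly {poly F}}).

(* The outer variable of {poly {poly F}} is s, the inner one is t. *)
Definition eval2 a b h : F := h.[a%:P].[b].

Definition increment p : {poly {poly F}} := p^:P - p%:P.

Lemma eval2M a b : {morph eval2 a b : g h / g * h}.
Proof. by move=> g h; rewrite /eval2 !hornerM. Qed.

Lemma eval2_increment a b p : eval2 a b (increment p) = p.[a] - p.[b].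
Proof.
by rewrite /eval2 /increment hornerD hornerN hornerC horner_map /= hornerD hornerN hornerC.
Qed.

(** Evaluation of the outer variable at ['X] is restriction to the diagonal s = t. *)
Lemma horner_diag h a : h.['X].[a] = eval2 a a h.
Proof.
rewrite /eval2; elim/poly_ind: h => [|h c hE]; first by rewrite !horner0.
by rewrite !hornerE hE.
Qed.

Lemma horner_section h a b : (map_poly (horner_eval b) h).[a] = eval2 a b h.
Proof.
by have := horner_map (horner_eval b) h a%:P; rewrite /= /horner_eval hornerC.
Qed.

Lemma increment_diag p : (increment p).['X] = 0.
Proof. by rewrite hornerD hornerN hornerC -/(p \Po 'X) comp_polyXr subrr. Qed.

Lemma lead_coef_increment p : (1 < size p)%N ->
  lead_coef (increment p) = (lead_coef p)%:P.
Proof.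
move=> p_gt1; rewrite lead_coefDl ?lead_coef_map_inj //.
  exact: polyC_inj.
by rewrite size_polyN size_polyC size_map_polyC (leq_ltn_trans (leq_b1 _)).
Qed.

Lemma size_sub_monic (S : nzRingType) (f g : {poly S}) :
  f \is monic -> g \is monic -> size f = size g -> (size (f - g)%R < size f)%N.
Proof.
move=> f_mon g_mon fg; have := monic_neq0 f_mon; rewrite -size_poly_gt0.
case sf: (size f) => [//|m] _; rewrite ltnS; apply/leq_sizeP => j.
rewrite leq_eqVlt => /predU1P[<-|mj].
  move: f_mon g_mon; rewrite !monicE !lead_coefE -fg sf /= coefB.
  by move=> /eqP-> /eqP->; rewrite subrr.
by rewrite coefB !nth_default ?subrr // -?fg sf.
Qed.

Variables X Y : {poly F}.
Hypothesis X_gt1 : (1 < size X)%N.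

(** [K] is the greatest common divisor of the two increments over the fractions in t, and [c] is a
    common denominator in its Bezout identity. *)
Lemma common_factor : exists K F1 G1 u w c,
  [/\ K \is monic, increment X = F1 * K, increment Y = G1 * K, c != 0 &
      c%:P * K = u * increment X + w * increment Y].
Proof.
pose J h := exists c u w, c != 0 /\ c%:P * h = u * increment X + w * increment Y.
have leadX : lead_coef X != 0 by rewrite lead_coef_eq0 -size_poly_gt0 ltnW.
have X_neq0 : increment X != 0.
  by rewrite -lead_coef_eq0 lead_coef_increment // polyC_eq0.
have JX : J (increment X) by exists 1, 1, 0; rewrite oner_neq0 mul0r addr0.
have JY : J (increment Y) by exists 1, 0, 1; rewrite oner_neq0 mul0r add0r.
have [||| K0 [c [u [w [c_neq0 cK0]]]] KP] := saturated_ideal_principal _ _ _ JX X_neq0.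
- move=> g h [c [u [w [c_neq0 cg]]]] [c' [u' [w' [c'_neq0 cg']]]].
  exists (c * c'), (c'%:P * u - c%:P * u'), (c'%:P * w - c%:P * w').
  split; first by rewrite mulf_neq0.
  have -> : (c * c')%:P * (g - h) = c'%:P * (c%:P * g) - c%:P * (c'%:P * h).
    by rewrite polyCM; ring.
  by rewrite cg cg'; ring.
- move=> g h [c [u [w [c_neq0 cg]]]]; exists c, (h * u), (h * w); split => //.
  by rewrite mulrCA cg; ring.
- move=> d g d_neq0 [c [u [w [c_neq0 cg]]]]; exists (c * d), u, w.
  by rewrite mulf_neq0 // polyCM -mulrA.
have [F1 FE] := KP _ JX; have [G1 GE] := KP _ JY.
(* The leading coefficient of [K0] divides that of [increment X], a nonzero constant; hence [K0] can
   be made monic. *)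
have [d d_neq0 K0d] : exists2 d, d != 0 & lead_coef K0 = d%:P.
  have K0F1 : lead_coef F1 * lead_coef K0 = (lead_coef X)%:P.
    by rewrite -lead_coefM -FE lead_coef_increment.
  have lX : lead_coef K0 %| (lead_coef X)%:P by rewrite -K0F1 dvdp_mulIr.
  have := dvdp_leq _ lX; rewrite polyC_eq0 size_polyC leadX => /(_ isT) le1.
  have dE := size1_polyC le1; exists (lead_coef K0)`_0 => //.
  apply: contraNneq leadX => d0; rewrite -(polyC_eq0 (lead_coef X)) -K0F1.
  by rewrite dE d0 mulr0.
exists (d^-1%:P%:P * K0), (d%:P%:P * F1), (d%:P%:P * G1), (d^-1%:P%:P * u).
exists (d^-1%:P%:P * w), c.
have dd : d%:P%:P * d^-1%:P%:P = 1 :> {poly {poly F}}.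
  by rewrite -!polyCM mulfV.
split=> //.
- by rewrite monicE lead_coefM lead_coefC K0d -polyCM mulVf.
- by rewrite mulrACA dd mul1r.
- by rewrite mulrACA dd mul1r.
- by rewrite mulrCA cK0 mulrDr !mulrA.
Qed.

Section CommonFactor.
Variables (K F1 G1 u w : {poly {poly F}}) (c : {poly F}).
Hypothesis K_monic : K \is monic.
Hypothesis XE : increment X = F1 * K.
Hypothesis YE : increment Y = G1 * K.
Hypothesis c_neq0 : c != 0.
Hypothesis cK : c%:P * K = u * increment X + w * increment Y.

(** On the diagonal both increments in the Bezout identity vanish, while [c] is a nonzero
    polynomial. *)
Lemma common_factor_diag : K.['X] = 0.
Proof.
have := congr1 (horner^~ 'X) cK.
rewrite /= hornerD !hornerM hornerC !increment_diag !mulr0 addr0 => /eqP.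
by rewrite mulf_eq0 (negPf c_neq0) => /eqP.
Qed.

Lemma common_factor_primitive : primitive K.
Proof.
by apply: (@unit_lead_coef_primitive _ _ 1) (oner_neq0 _) _; apply/eqP.
Qed.

(* With a third variable r, X(r) - X(t) = X(r) - X(s) modulo K(s, t), so
   K(r, s) divides c(t) K(r, t) modulo K(s, t); both being monic of the same
   degree in r, they agree modulo K(s, t). *)
Lemma increment_coef_common_factor i : exists z, increment K`_i = z * K.
Proof.
(* With variables r, s, t from the outermost inwards, [in_t] sends h to h(r, t) and [in_s] sends it
   to h(r, s). *)
pose in_t : {rmorphism {poly {poly F}} -> {poly {poly {poly F}}}} := map_poly polyC.
pose in_s : {rmorphism {poly {poly F}} -> {poly {poly {poly F}}}} :=
  map_poly (map_poly polyC).
have in_increment p : in_t (increment p) = in_s (increment p) + (increment p)%:P.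
  rewrite /increment !rmorphB /= !map_polyC /= addrA; congr (_ - _).
  rewrite subrK -!map_poly_comp; apply: eq_map_poly => a /=.
  by rewrite map_polyC.
pose v := in_t u * F1%:P + in_t w * G1%:P.
have Ks_monic : in_s K \is monic by apply: monic_map.
have Kt_monic : in_t K \is monic by apply: monic_map.
have sizeK : size (in_s K) = size (in_t K).
  rewrite !size_map_inj_poly ?rmorph0 //; first exact: polyC_inj.
  by apply: map_inj_poly => //; apply: polyC_inj.
have cKt : c%:P%:P * in_t K =
    (in_t u * in_s F1 + in_t w * in_s G1) * in_s K + K%:P * v.
  have := congr1 in_t cK; rewrite rmorphM rmorphD !rmorphM !in_increment XE YE.
  by rewrite /= map_polyC /= /v !rmorphM /= => ->; ring.
pose v' := Pdiv.Ring.rmodp v (in_s K).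
have vE := Pdiv.RingMonic.rdivp_eq Ks_monic v.
(* This is a multiple of K(r, s) of lower degree in r, hence zero: the difference of two monic
   polynomials of equal degree drops in degree, and [v'] is a remainder. *)
pose N := c%:P%:P * (in_s K - in_t K) + K%:P * v'.
have [Q NQ] : exists Q, N = Q * in_s K.
  exists (c%:P%:P - (in_t u * in_s F1 + in_t w * in_s G1) -
          K%:P * Pdiv.Ring.rdivp v (in_s K)).
  by rewrite /N mulrBr cKt {1}vE -/v'; ring.
have N0 : N = 0.
  have sN : (size N < size (in_s K))%N.
    apply: leq_ltn_trans (size_polyD _ _) _; rewrite gtn_max !mul_polyC.
    rewrite (leq_ltn_trans (size_scale_leq _ _)) ?size_sub_monic //=.
    rewrite (leq_ltn_trans (size_scale_leq _ _)) //.
    by rewrite Pdiv.Ring.ltn_rmodpN0 // monic_neq0.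
  apply/eqP; apply: contraLR sN => N_neq0; rewrite -leqNgt NQ.
  have Q_neq0 : Q != 0 by apply: contraNneq N_neq0 => Q0; rewrite NQ Q0 mul0r.
  by rewrite size_Mmonic // -(prednK (_ : 0 < size Q)%N) ?size_poly_gt0 // addSn leq_addl.
have cKi : c%:P * increment K`_i = - v'`_i * K.
  have := congr1 (fun f : {poly {poly {poly F}}} => f`_i) N0.
  rewrite coefD !coefCM coefB coef0 !coef_map /= => /eqP.
  by rewrite addr_eq0 => /eqP->; rewrite mulNr mulrC.
exact: (primitive_dvd common_factor_primitive c_neq0 cKi).
Qed.

(** At a zero s = a, t = b of [K] the congruence of K(r, s) and K(r, t) modulo K(s, t) becomes an
    equality, coefficient by coefficient in r. *)
Lemma common_factor_coef a b : eval2 a b K = 0 -> forall i, (K`_i).[a] = (K`_i).[b].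
Proof.
move=> Kab i; have [z zE] := increment_coef_common_factor i.
by apply/eqP; rewrite -subr_eq0 -eval2_increment zE eval2M Kab mulr0.
Qed.

(** Cancelling [K] leaves A F1 + B G1 = 0 and turns the Bezout identity into c = u F1 + w G1. So
    [F1] divides c B and, being primitive, divides [B]. *)
Lemma separated_syzygy A B : A * increment X + B * increment Y = 0 ->
  exists E, A = G1 * E /\ B = - (F1 * E).
Proof.
have K_neq0 := monic_neq0 K_monic.
have F1_neq0 : F1 != 0.
  apply: contraTneq X_gt1 => F10; have := lead_coef_increment X_gt1.
  rewrite XE F10 mul0r lead_coef0 => /esym/eqP.
  by rewrite polyC_eq0 lead_coef_eq0 => /eqP->; rewrite size_poly0.
have uw : c%:P = u * F1 + w * G1.
  by apply: (mulIf K_neq0); rewrite cK XE YE; ring.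
rewrite XE YE !mulrA -mulrDl => /eqP; rewrite mulf_eq0 (negPf K_neq0) orbF.
rewrite addr_eq0 => /eqP AF.
have F1_prim : primitive F1.
  apply: (@unit_lead_coef_primitive _ _ (lead_coef X)).
    by rewrite lead_coef_eq0 -size_poly_gt0 ltnW.
  by rewrite -lead_coef_increment // XE lead_coef_Mmonic.
have cB : c%:P * B = (u * B - w * A) * F1.
  by rewrite uw mulrBl -[w * A * F1]mulrA AF; ring.
have [z zE] := primitive_dvd F1_prim c_neq0 cB.
exists (- z); rewrite zE; split; last by ring.
by apply: (mulIf F1_neq0); rewrite AF zE; ring.
Qed.

End CommonFactor.
End TwoParameters.

(** * Zeros of the common factor off the diagonal *)

Section RealParameters.
Variables (R : realType) (X Y : {poly R}).
Hypothesis immersion : forall t, (X^`().[t] != 0) || (Y^`().[t] != 0).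

Lemma common_factor_separates K F1 G1 u w c a b : K \is monic ->
  increment X = F1 * K -> increment Y = G1 * K -> c != 0 ->
  c%:P * K = u * increment X + w * increment Y -> a != b -> eval2 a b K != 0.
Proof.
move=> K_monic XE YE c_neq0 cK ab; apply/eqP => Kab.
have coefK := common_factor_coef K_monic XE YE c_neq0 cK.
have diag := common_factor_diag c_neq0 cK.
(* Since K(t, t) = 0, the s-derivatives of the increments on the diagonal show X' and Y' as
   multiples of K_s(t, t), so a zero of the latter contradicts [immersion]. *)
have slope_neq0 t : K^`().['X].[t] != 0.
  have deriv_diag p H : increment p = H * K -> p^`() = H.['X] * K^`().['X].
    move=> pE; have := congr1 (fun h => h^`().['X]) pE.
    rewrite /= /increment derivB derivC subr0 derivM hornerD !hornerM diag mulr0 add0r.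
    by rewrite deriv_map -/(_ \Po 'X) comp_polyXr.
  move: (immersion t); rewrite (deriv_diag _ _ XE) (deriv_diag _ _ YE) !hornerM.
  by rewrite !mulf_eq0 -negb_and; apply: contra => ->; rewrite !orbT.
pose q := map_poly (horner_eval b) K.
have qE x : q.[x] = eval2 x b K by apply: horner_section.
(* At a root x the polynomials K(., b) and K(., x) coincide. *)
have q' x : root q x -> q^`().[x] = K^`().['X].[x].
  rewrite /root qE => /eqP /coefK Kxb.
  have -> : q = map_poly (horner_eval x) K.
    by apply/polyP => i; rewrite !coef_map /= /horner_eval Kxb.
  by rewrite deriv_map horner_diag horner_section.
have [ra rb] : root q a /\ root q b.
  by rewrite /root !qE Kab -horner_diag diag horner0.
(* The slopes at all roots of [q] have one strict sign, but between two such roots there would be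
   one whose slope is zero or of the other sign. *)
have apart x y : x < y -> root q x -> root q y -> False.
  move=> xy rx ry; have same := neq0_horner_same_sign _ _ slope_neq0.
  have [slope_gt0|slope_lt0|/eqP] := ltrgt0P K^`().['X].[x];
    last by rewrite (negPf (slope_neq0 x)).
    have [||z [_ _ rz]] := simple_roots_separated xy rx ry; rewrite ?q' //.
      by rewrite -(pmulr_rgt0 _ slope_gt0).
    by rewrite leNgt -(pmulr_rgt0 _ slope_gt0) same.
  have [||||z [_ _ rz]] := @simple_roots_separated _ (- q) _ _ xy; rewrite ?rootN //.
  - by rewrite derivN hornerN q' // oppr_gt0.
  - by rewrite derivN hornerN q' // oppr_gt0 -(nmulr_rgt0 _ slope_lt0).
  rewrite rootN in rz; rewrite derivN hornerN q' // oppr_le0.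
  by rewrite leNgt -(nmulr_rgt0 _ slope_lt0) same.
by case: (ltgtP a b) ab => // ab _; [apply: apart ab _ _|apply: apart ab _ _].
Qed.

End RealParameters.

(** * Symmetric difference quotients *)

Section DifferenceQuotients.
Variables (R : realType) (n : nat) (beta : 'I_n -> {poly R}).
Implicit Types (g : {mpoly R[n]}) (h : {poly {poly R}}).

(** The rules of the derivation sigma d/ds + tau d/dt at the point (a, b); they let the derivatives
    in s and in t be treated at once. *)
Definition tangent_derivation (a b sigma tau : R) (D : {poly {poly R}} -> R) :=
  [/\ forall h k, D (h + k) = D h + D k,
      forall h k, D (h * k) = D h * eval2 a b k + eval2 a b h * D k,
      forall p : {poly R}, D p^:P = sigma * p^`().[a] &
      forall p : {poly R}, D p%:P = tau * p^`().[b]].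

Lemma tangent_derivation_s a b :
  tangent_derivation a b 1 0 (fun h => eval2 a b h^`()).
Proof.
split=> [g h|g h|p|p]; rewrite /eval2.
- by rewrite derivD !hornerE.
- by rewrite derivM !hornerE.
- by rewrite deriv_map horner_map hornerC mul1r.
- by rewrite derivC !horner0 mul0r.
Qed.

Lemma tangent_derivation_t a b :
  tangent_derivation a b 0 1 (fun h => h.[a%:P]^`().[b]).
Proof.
split=> [g h|g h|p|p]; rewrite /eval2.
- by rewrite hornerD derivD hornerD.
- by rewrite hornerM derivM !hornerE.
- by rewrite horner_map derivC horner0 mul0r.
- by rewrite hornerC mul1r.
Qed.

(* The symmetric choice of A makes its derivative at a point over which a and b
   lie half the Hessian applied to the sum of the two displacements. *)
Lemma difference_quotient g : exists A : 'I_n -> {poly {poly R}},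
  increment (along beta g) = \sum_i A i * increment (beta i) /\
  forall a b, (forall i, (beta i).[a] = (beta i).[b]) -> forall i,
    eval2 a b (A i) = (along beta g^`M(i)).[a] /\
    forall sigma tau D, tangent_derivation a b sigma tau D ->
      D (A i) *+ 2 = \sum_j (along beta g^`M(i)^`M(j)).[a] *
                       (sigma * (beta j)^`().[a] + tau * (beta j)^`().[b]).
Proof.
elim/mpoly_ring_ind: g => [c|k|p q [A [pA AP]] [B [qB BP]]|p q [A [pA AP]] [B [qB BP]]].
- exists (fun=> 0); rewrite /along mmapC; split.
    by rewrite /increment map_polyC subrr big1 // => i _; rewrite mul0r.
  move=> a b _ i; rewrite mderivC mmap0 horner0 /eval2 !horner0; split=> //.
  move=> sigma tau D [_ _ _ DC]; rewrite DC derivC horner0 mulr0 mul0rn.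
  by rewrite big1 // => j _; rewrite mderiv0 mmap0 horner0 mul0r.
- exists (fun i => (k == i)%:R%:P%:P); split.
    rewrite /along mmapX mmap1U (bigD1 k) //= eqxx mul1r big1 ?addr0 // => i.
    by rewrite eq_sym => /negPf->; rewrite mul0r.
  move=> a b _ i; rewrite mderivXU /along mmapC /eval2 !hornerC; split=> //.
  move=> sigma tau D [_ _ _ DC]; rewrite DC derivC horner0 mulr0 mul0rn.
  by rewrite big1 // => j _; rewrite mderivC mmap0 horner0 mul0r.
- exists (fun i => A i + B i); split.
    rewrite /along mmapD -!/(along _ _) /increment rmorphD polyCD opprD addrACA.
    rewrite -!/(increment _) pA qB -big_split /=.
    by apply: eq_bigr => i _; rewrite mulrDl.
  move=> a b ab i; have [Ai DA] := AP a b ab i; have [Bi DB] := BP a b ab i.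
  rewrite mderivD /along mmapD -!/(along _ _) hornerD -Ai -Bi /eval2 !hornerD.
  split=> // sigma tau D Dt; have [DD _ _ _] := Dt.
  rewrite DD mulrnDl (DA _ _ _ Dt) (DB _ _ _ Dt) -big_split /=.
  by apply: eq_bigr => j _; rewrite mderivD /along mmapD hornerD mulrDl.
(* The product rule p(s) q(s) - p(t) q(t) = (p(s) - p(t)) mean(q) + mean(p) (q(s) - q(t)), with
   means over s and t, keeps the quotients symmetric in s and t. *)
pose half : {poly {poly R}} := (2^-1)%:P%:P.
pose mean p := half * ((along beta p)^:P + (along beta p)%:P).
have alongM (g h : {mpoly R[n]}) : along beta (g * h) = along beta g * along beta h.
  by rewrite /along rmorphM.
have alongD (g h : {mpoly R[n]}) : along beta (g + h) = along beta g + along beta h.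
  by rewrite /along rmorphD.
have half2 : half + half = 1.
  by rewrite /half -!polyCD (_ : 2^-1 + 2^-1 = 1 :> R) //; lra.
exists (fun i => A i * mean q + mean p * B i); split.
  under eq_bigr do rewrite mulrDl mulrAC -[mean p * _ * _]mulrA.
  rewrite big_split /= -mulr_suml -mulr_sumr -pA -qB.
  rewrite alongM /increment /mean rmorphM polyCM.
  set ps := _^:P; set pt := _%:P; set qs := (along _ q)^:P; set qt := (along _ q)%:P.
  rewrite -[LHS]mul1r -half2; ring.
move=> a b ab i; have [Ai DA] := AP a b ab i; have [Bi DB] := BP a b ab i.
have same g : (along beta g).[b] = (along beta g).[a].
  by rewrite !horner_along; apply: meval_eq => k; rewrite ab.
have evmean g : eval2 a b (mean g) = (along beta g).[a].
  rewrite /mean eval2M /eval2 /half !hornerE horner_map !hornerE same; lra.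
split.
  rewrite mderivM alongD !alongM hornerD !hornerM -Ai -Bi.
  by rewrite -(evmean p) -(evmean q) -!eval2M /eval2 !hornerD.
move=> sigma tau D Dt; have [DD DM Ds DT] := Dt.
have Dmean g : D (mean g) *+ 2 = \sum_j (along beta g^`M(j)).[a] *
                       (sigma * (beta j)^`().[a] + tau * (beta j)^`().[b]).
  rewrite DM DT derivC horner0 mulr0 mul0r add0r DD Ds DT /half /eval2 !hornerC.
  rewrite !deriv_along !horner_sum !mulr_sumr -big_split /= mulr_sumr -sumrMnl.
  by apply: eq_bigr => j _; rewrite !hornerM same; lra.
rewrite DD (DM (A i) (mean q)) (DM (mean p) (B i)) !evmean Ai Bi.
rewrite [LHS](_ : _ = D (A i) *+ 2 * (along beta q).[a]
  + (along beta p^`M(i)).[a] * (D (mean q) *+ 2)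
  + (D (mean p) *+ 2 * (along beta q^`M(i)).[a]
  + (along beta p).[a] * (D (B i) *+ 2))); last by ring.
rewrite !Dmean (DA _ _ _ Dt) (DB _ _ _ Dt) !mulr_suml !mulr_sumr -!big_split /=.
apply: eq_bigr => j _.
rewrite mderivM mderivD !mderivM !(alongD, alongM) !(hornerD, hornerM); ring.
Qed.

End DifferenceQuotients.

(** * Nodes and Hessians *)

Section BinaryQuadraticForms.
Variable R : realFieldType.
Implicit Types A B D e k : R.

(** When A D = B^2, (A p + B q)^2 is A times the value of the form and (B p + D q)^2 is D times it,
    so null vectors lie in the kernel; two independent ones leave only the zero form. *)
Lemma rank1_form_null_line A B D (p q r s : R) :
  A * D = B ^+ 2 -> p * s != q * r ->
  A * p ^+ 2 + 2 * B * p * q + D * q ^+ 2 = 0 ->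
  A * r ^+ 2 + 2 * B * r * s + D * s ^+ 2 = 0 -> [/\ A = 0, B = 0 & D = 0].
Proof.
move=> det0 indep pq0 rs0.
have ind : p * s - q * r != 0 by rewrite subr_eq0.
have E1 : A * p + B * q = 0.
  apply/eqP; rewrite -sqrf_eq0; apply/eqP.
  have -> : (A * p + B * q) ^+ 2 =
    A * (A * p ^+ 2 + 2 * B * p * q + D * q ^+ 2) + (B ^+ 2 - A * D) * q ^+ 2 by ring.
  by rewrite pq0 det0; ring.
have E2 : A * r + B * s = 0.
  apply/eqP; rewrite -sqrf_eq0; apply/eqP.
  have -> : (A * r + B * s) ^+ 2 =
    A * (A * r ^+ 2 + 2 * B * r * s + D * s ^+ 2) + (B ^+ 2 - A * D) * s ^+ 2 by ring.
  by rewrite rs0 det0; ring.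
have E3 : B * p + D * q = 0.
  apply/eqP; rewrite -sqrf_eq0; apply/eqP.
  have -> : (B * p + D * q) ^+ 2 =
    D * (A * p ^+ 2 + 2 * B * p * q + D * q ^+ 2) + (B ^+ 2 - A * D) * p ^+ 2 by ring.
  by rewrite pq0 det0; ring.
have E4 : B * r + D * s = 0.
  apply/eqP; rewrite -sqrf_eq0; apply/eqP.
  have -> : (B * r + D * s) ^+ 2 =
    D * (A * r ^+ 2 + 2 * B * r * s + D * s ^+ 2) + (B ^+ 2 - A * D) * r ^+ 2 by ring.
  by rewrite rs0 det0; ring.
split; apply: (mulIf ind); rewrite mul0r.
- have -> : A * (p * s - q * r) = (A * p + B * q) * s - (A * r + B * s) * q by ring.
  by rewrite E1 E2; ring.
- have -> : B * (p * s - q * r) = (B * p + D * q) * s - (B * r + D * s) * q by ring.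
  by rewrite E3 E4; ring.
- have -> : D * (p * s - q * r) = p * (B * r + D * s) - r * (B * p + D * q) by ring.
  by rewrite E3 E4; ring.
Qed.

(** The image of (x, y) under the symmetric matrix is orthogonal to (x, y); were it also orthogonal
    to (y, - x), it would vanish, against nondegeneracy. *)
Lemma nondegenerate_null_vector A B D (x y : R) :
  A * D != B ^+ 2 -> (x != 0) || (y != 0) ->
  (A * x + B * y) * x + (B * x + D * y) * y = 0 ->
  (A * x + B * y) * y - (B * x + D * y) * x != 0.
Proof.
move=> det xy0 null; apply/eqP => perp.
set a := A * x + B * y in null perp; set b := B * x + D * y in null perp.
have nrm : x ^+ 2 + y ^+ 2 != 0.
  by rewrite paddr_eq0 ?sqr_ge0 // !sqrf_eq0 negb_and.
have a0 : a = 0.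
  apply: (mulIf nrm); rewrite mul0r.
  have -> : a * (x ^+ 2 + y ^+ 2) = (a * x + b * y) * x + (a * y - b * x) * y by ring.
  by rewrite null perp; ring.
have b0 : b = 0.
  apply: (mulIf nrm); rewrite mul0r.
  have -> : b * (x ^+ 2 + y ^+ 2) = (a * x + b * y) * y - (a * y - b * x) * x by ring.
  by rewrite null perp; ring.
move/negP: det; apply; rewrite -subr_eq0; apply/eqP.
have Ex : (A * D - B ^+ 2) * x = a * D - b * B by rewrite /a /b; ring.
have Ey : (A * D - B ^+ 2) * y = b * A - a * B by rewrite /a /b; ring.
by case/orP: xy0 => z0; apply: (mulIf z0); rewrite mul0r ?Ex ?Ey a0 b0; ring.
Qed.

(** The product of the two slopes, times k^2, is - e^2 (x^2 + y^2) (z^2 + w^2). *)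
Lemma opposite_slopes k e (a0 a1 b0 b1 x y z w : R) : k != 0 ->
  k * a0 = e * y -> k * a1 = - (e * x) -> k * b0 = - (e * w) -> k * b1 = e * z ->
  a0 * y - a1 * x != 0 -> b0 * w - b1 * z != 0 ->
  (a0 * y - a1 * x) * (b0 * w - b1 * z) < 0.
Proof.
move=> k0 a0E a1E b0E b1E pa pb.
rewrite lt_neqAle mulf_neq0 //= -(pmulr_rle0 _ (_ : 0 < k ^+ 2)); last first.
  by rewrite exprn_even_gt0.
have -> : k ^+ 2 * ((a0 * y - a1 * x) * (b0 * w - b1 * z)) =
  (k * a0 * y - k * a1 * x) * (k * b0 * w - k * b1 * z) by ring.
rewrite a0E a1E b0E b1E.
have -> : (e * y * y - - (e * x) * x) * (- (e * w) * w - e * z * z) =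
  - (e ^+ 2 * ((x ^+ 2 + y ^+ 2) * (z ^+ 2 + w ^+ 2))) by ring.
by rewrite oppr_le0 mulr_ge0 ?sqr_ge0 // mulr_ge0 // addr_ge0 ?sqr_ge0.
Qed.

End BinaryQuadraticForms.

Section LocalStructure.
Variable R : realType.
Implicit Types (g f L : {mpoly R[2]}) (P : 'rV[R]_2) (C : set 'rV[R]_2).

Lemma multiplicity_uniq C P k l : multiplicity C P k -> multiplicity C P l -> k = l.
Proof.
move=> [lowk [g Cg gk]] [lowl [h Ch hl]].
case: (ltngtP k l) => // [kl|lk].
  by rewrite lowl ?eqxx in gk.
by rewrite lowk ?eqxx in hl.
Qed.

Lemma taylor_form1_eq0 g P :
  taylor_form 1 g P = 0 <-> forall i, g^`M(i).@[P 0] = 0.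
Proof.
split=> [g0 i|g0].
  have := meval_taylor_form1 g P (fun j => (j == i)%:R).
  rewrite g0 meval0 (bigD1 i) //= eqxx mul1r big1 ?addr0 // => j /negPf->.
  by rewrite mul0r.
apply: mpoly_eval_eq0 => u; rewrite meval_taylor_form1 big1 // => i _.
by rewrite g0 mulr0.
Qed.

Lemma taylor_form2_eq0 g P :
  (forall i j, g^`M(i)^`M(j).@[P 0] = 0) -> taylor_form 2 g P = 0.
Proof.
move=> g0; apply: mpoly_eval_eq0 => u.
suff /eqP : (taylor_form 2 g P).@[u] *+ 2 = 0 by rewrite mulrn_eq0 => /eqP.
rewrite meval_taylor_form2 big1 // => i _.
by rewrite big1 // => j _; rewrite g0 mulr0.
Qed.

Lemma meval_linear_form L : L \is 1.-homog ->
  exists a b, forall u, L.@[u] = a * u 0 + b * u 1.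
Proof.
move=> L1; exists L^`M(0).@[(0 : 'rV[R]_2) 0], L^`M(1).@[(0 : 'rV[R]_2) 0] => u.
rewrite -{1}(pihomog_dE L1) -coef_along_ray.
have -> : (fun i => u i *: 'X) = (fun i => ((0 : 'rV[R]_2) 0 i)%:P + u i *: 'X).
  by apply/funext => i; rewrite mxE add0r.
rewrite -meval_taylor_form meval_taylor_form1 !big_ord_recl big_ord0 addr0.
rewrite ![u _ * _]mulrC; congr (_ + _ * u _); last exact: val_inj.
by congr (_^`M(_).@[_]); apply: val_inj.
Qed.

Lemma hessian_mulr_vanishing g f P i j : f.@[P 0] = 0 ->
  (forall k, f^`M(k).@[P 0] = 0) ->
  (g * f)^`M(i)^`M(j).@[P 0] = g.@[P 0] * f^`M(i)^`M(j).@[P 0].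
Proof.
move=> f0 df0; rewrite mderivM mderivD !mderivM !mevalD !mevalM f0 !df0.
by rewrite !mulr0 !add0r.
Qed.

Lemma gradient_mulr_vanishing g f P i : f.@[P 0] = 0 ->
  (g * f)^`M(i).@[P 0] = g.@[P 0] * f^`M(i).@[P 0].
Proof. by move=> f0; rewrite mderivM mevalD !mevalM f0 mulr0 add0r. Qed.

(** Both tangent lines consist of null vectors of the Hessian of [f]. A degenerate Hessian would
    thus be zero, and no multiple of [f] could have a nonzero quadratic form at P, against
    multiplicity 2. *)
Lemma node_hessian C P f : vanishes_on C f ->
  (forall g, vanishes_on C g -> exists h, g = h * f) -> node C P ->
  (forall i, f^`M(i).@[P 0] = 0) /\
  f^`M(0)^`M(0).@[P 0] * f^`M(1)^`M(1).@[P 0] != f^`M(0)^`M(1).@[P 0] ^+ 2.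
Proof.
move=> Cf gen [CP mult2 [L1 [L2 [tan1 tan2 L12]]]].
have f0 : f.@[P 0] = 0 by apply: Cf.
have df0 : forall i, f^`M(i).@[P 0] = 0.
  by apply/taylor_form1_eq0; apply: mult2.1.
split=> //; apply/negP => /eqP det0.
set A := f^`M(0)^`M(0).@[P 0] in det0; set D := f^`M(1)^`M(1).@[P 0] in det0.
set B := f^`M(0)^`M(1).@[P 0] in det0.
have form2 u : (taylor_form 2 f P).@[u] *+ 2 =
    A * u 0 ^+ 2 + 2 * B * u 0 * u 1 + D * u 1 ^+ 2.
  rewrite meval_taylor_form2 !big_ord_recl !big_ord0 !addr0.
  have -> : lift ord0 ord0 = 1 :> 'I_2 by apply: val_inj.
  rewrite -/A -/B -/D (mderiv_comm 1 0) -/B; ring.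
have null L : tangent_line C P L -> forall u, L.@[u] = 0 ->
    A * u 0 ^+ 2 + 2 * B * u 0 * u 1 + D * u 1 ^+ 2 = 0.
  move=> [_ _ [k multk /(_ f Cf)]].
  rewrite (multiplicity_uniq multk mult2) => -[h fE] u Lu.
  by rewrite -form2 fE mevalM Lu mulr0 mul0rn.
have [L1_neq0 L1_homog _] := tan1; have [L2_neq0 L2_homog _] := tan2.
have [a [b L1E]] := meval_linear_form L1_homog.
have [c [d L2E]] := meval_linear_form L2_homog.
have [g Cg g2] := mult2.2.
(* The lines have directions (b, - a) and (d, - c); were these parallel, [L2] would be [L1] times c
   / a, or times d / b when a = 0. *)
have indep : b * - c != - a * d.
  apply/eqP => bcad.
  have [a0 b0] : a = 0 /\ b = 0.
    have [a0|a_neq0] := eqVneq a 0.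
      split=> //; apply/eqP; apply: contraT => b_neq0.
      have c0 : c = 0.
        move: bcad; rewrite a0 oppr0 mul0r => /eqP.
        by rewrite mulf_eq0 (negPf b_neq0) oppr_eq0 => /eqP.
      have /eqP[] := L12 (d / b); apply/eqP; rewrite -subr_eq0; apply/eqP.
      apply: mpoly_eval_eq0 => u; rewrite mevalB mevalZ L1E L2E a0 c0; field.
      exact: b_neq0.
    have /eqP[] := L12 (c / a); apply/eqP; rewrite -subr_eq0; apply/eqP.
    apply: mpoly_eval_eq0 => u; rewrite mevalB mevalZ L1E L2E.
    have -> : d = b * c / a.
      apply: (mulIf a_neq0); rewrite mulfVK // mulrC.
      by apply: oppr_inj; rewrite -mulNr -bcad mulrN.
    field; exact: a_neq0.
  case/negP: L1_neq0; apply/eqP/mpoly_eval_eq0 => u.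
  by rewrite L1E a0 b0 !mul0r addr0.
pose vec (x y : R) := fun i : 'I_2 => if i == 0 then x else y.
have [A0 B0 D0] := rank1_form_null_line det0 indep
  (null L1 tan1 (vec b (- a)) ltac:(by rewrite L1E /vec /=; ring))
  (null L2 tan2 (vec d (- c)) ltac:(by rewrite L2E /vec /=; ring)).
case/negP: g2; apply/eqP/taylor_form2_eq0 => i j.
have [h ->] := gen g Cg; rewrite hessian_mulr_vanishing //.
have ord2 (k : 'I_2) : k = 0 \/ k = 1.
  by case: (unliftP ord0 k) => [l|] ->; [right|left] => //; apply: val_inj; rewrite /= ord1.
suff -> : f^`M(i)^`M(j).@[P 0] = 0 by rewrite mulr0.
case: (ord2 i) (ord2 j) => -> [] -> //; by rewrite mderiv_comm.
Qed.

(** The linear form of h f at P is h(P) times that of f, so a vanishing gradient of [f] would leave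
    no element of order 1. *)
Lemma nonsingular_gradient C P f : vanishes_on C f ->
  (forall g, vanishes_on C g -> exists h, g = h * f) -> C P ->
  multiplicity C P 1 -> exists i, f^`M(i).@[P 0] != 0.
Proof.
move=> Cf gen CP [_ [g Cg g1]].
apply: contra_notP (elimN eqP g1) => df0; apply/taylor_form1_eq0 => i.
have [h ->] := gen g Cg; rewrite gradient_mulr_vanishing; last exact: Cf.
apply/eqP; rewrite mulf_eq0; apply/orP; right; apply: contraT => dfi.
by case: df0; exists i.
Qed.

End LocalStructure.

(** * Sides of a nodal curve *)

(** Serves to exclude a node with a single parameter, once no node has more than two. *)
Lemma card_lt_of_small_fibers m n (phi : 'I_m -> 'I_n) (k0 : 'I_n) :
  (forall k, #|[set i | phi i == k]| <= 2)%N ->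
  (#|[set i | phi i == k0]| <= 1)%N -> (m < 2 * n)%N.
Proof.
move=> le2 le1; rewrite -[m in (m < _)%N]card_ord -sum1_card.
rewrite (partition_big phi predT) //=.
under eq_bigr => k _ do rewrite sum1dep_card.
have -> : (2 * n = \sum_(k < n) 2)%N by rewrite sum_nat_const card_ord mulnC.
rewrite (bigD1 k0) //= [X in (_ < X)%N](bigD1 k0) //= -addSn.
by apply: leq_add => //; apply: leq_sum.
Qed.

Local Open Scope classical_set_scope.

Section NodalCurve.
Variables (R : realType) (C : set 'rV[R]_2) (alpha : 'rV[{poly R}]_2).
Hypothesis nodal : nodal_parametrization C alpha.
Implicit Types (g : {mpoly R[2]}) (P : 'rV[R]_2).

Local Notation X := (alpha 0 0).
Local Notation Y := (alpha 0 1).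
Local Notation pullback := (along (alpha 0)).

Lemma horner_pullback g s : (pullback g).[s] = g.@[curve_point alpha s 0].
Proof. by rewrite horner_along; apply: meval_eq => i; rewrite mxE. Qed.

Lemma curve_point_in s : C (curve_point alpha s).
Proof. by case: nodal => -> _ _; exists s. Qed.

Lemma vanishes_onE g : vanishes_on C g <-> pullback g = 0.
Proof.
split=> [Cg|g0 P].
  apply: poly_eval_eq0 => s; rewrite horner_pullback.
  exact: Cg (curve_point_in s).
by case: nodal => -> _ _ [s _ <-]; rewrite -horner_pullback g0 horner0.
Qed.

Lemma immersion s : (X^`().[s] != 0) || (Y^`().[s] != 0).
Proof.
have [_ /(_ s) + _] := nodal; apply: contraNT; rewrite negb_or !negbK.
move=> /andP[/eqP X0 /eqP Y0]; apply/eqP/matrixP => i j.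
rewrite !mxE (ord1 i); case: (unliftP ord0 j) => [k|] -> //.
by rewrite (_ : lift ord0 k = 1) //; apply: val_inj; rewrite /= ord1.
Qed.

Lemma pullbackM g h : pullback (g * h) = pullback g * pullback h.
Proof. by rewrite /along rmorphM. Qed.

Lemma pullbackB g h : pullback (g - h) = pullback g - pullback h.
Proof. by rewrite /along rmorphB. Qed.

Lemma pullback_to_mpolyC (c : {poly R}) : pullback (to_mpoly R c%:P) = c \Po X.
Proof.
rewrite to_mpolyC; elim/poly_ind: c => [|c d cE].
  by rewrite rmorph0 horner0 comp_poly0 /along mmap0.
rewrite comp_polyD comp_polyM comp_polyX comp_polyC -cE.
rewrite rmorphD rmorphM /= map_polyX map_polyC !hornerE.
by rewrite /along mmapD rmorphM /= mmapX mmap1U mmapC.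
Qed.

(* On a vertical line, x - c has multiplicity 1 everywhere. *)
Lemma node_nonvertical P : node C P -> (1 < size X)%N.
Proof.
move=> [_ [low _] _]; rewrite ltnNge; apply/negP => X_le1.
have Xc := size1_polyC X_le1.
pose g : {mpoly R[2]} := 'X_0 - (X`_0)%:MP.
have Cg : vanishes_on C g.
  by apply/vanishes_onE; rewrite pullbackB /along mmapX mmap1U mmapC /= -Xc subrr.
have /taylor_form1_eq0/(_ 0) := low g Cg 1 isT.
rewrite mderivB mderivC mderivXU eqxx subr0 mevalC => /eqP.
by rewrite oner_eq0.
Qed.

(** A nonzero polynomial in x pulls back to a nonzero polynomial because X is not constant, so the
    ideal of C is saturated, hence principal; multiplicity 2 provides a nonzero element. *)
Lemma curve_equation P : node C P ->
  exists2 f, vanishes_on C f & forall g, vanishes_on C g -> exists h, g = h * f.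
Proof.
move=> PC; have X_gt1 := node_nonvertical PC.
have [_ [_ [g1 Cg1 g1_neq0]] _] := PC.
have [h1 h1E] := to_mpoly_surj g1.
pose J h := pullback (to_mpoly R h) = 0.
have [||||| f Jf fP] := @saturated_ideal_principal R J h1.
- by move=> g h; rewrite /J rmorphB pullbackB => -> ->; rewrite subrr.
- by move=> g h; rewrite /J rmorphM pullbackM => ->; rewrite mulr0.
- move=> c g c_neq0; rewrite /J rmorphM pullbackM pullback_to_mpolyC => /eqP.
  rewrite mulf_eq0 => /orP[|/eqP //]; by rewrite comp_poly_eq0 // (negPf c_neq0).
- by rewrite /J h1E; apply/vanishes_onE.
- apply: contraNneq g1_neq0 => h10; rewrite -h1E h10 rmorph0.
  by rewrite /taylor_form comp_mpoly0 pihomog0.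
exists (to_mpoly R f) => [|g /vanishes_onE]; first exact/vanishes_onE.
have [h <-] := to_mpoly_surj g => /fP [q ->].
by exists (to_mpoly R q); rewrite rmorphM.
Qed.

Section Equation.
Variable f : {mpoly R[2]}.
Hypothesis Cf : vanishes_on C f.
Hypothesis f_gen : forall g, vanishes_on C g -> exists h, g = h * f.

(* grad f (alpha) = side / (X'^2 + Y'^2) * (Y', - X'): the sign of side tells on
   which side of the curve f is positive. *)
Definition side : {poly R} :=
  pullback f^`M(0) * Y^`() - pullback f^`M(1) * X^`().

Lemma pullback_gradient : pullback f^`M(0) * X^`() + pullback f^`M(1) * Y^`() = 0.
Proof.
have := deriv_along (alpha 0) f; move/vanishes_onE: (Cf) => ->.
rewrite deriv0 !big_ord_recl big_ord0 addr0.
by rewrite (_ : lift ord0 ord0 = 1) //; apply: val_inj.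
Qed.

Lemma deriv_pullback g :
  (pullback g)^`() = pullback g^`M(0) * X^`() + pullback g^`M(1) * Y^`().
Proof.
rewrite deriv_along !big_ord_recl big_ord0 addr0.
by rewrite (_ : lift ord0 ord0 = 1) //; apply: val_inj.
Qed.

(** The gradient is orthogonal to the velocity by [pullback_gradient]; a zero of [side] makes it
    orthogonal to the normal as well, hence zero, and then the multiplicity is not 1. *)
Lemma root_side s : root side s <-> node C (curve_point alpha s).
Proof.
have grad_s := congr1 (horner^~ s) pullback_gradient.
rewrite /= hornerD !hornerM horner0 in grad_s.
split=> [side0|nodeP].
  apply: contrapT => not_node; have [_ _ sing] := nodal.
  have [mult1|nmult1] := pselect (multiplicity C (curve_point alpha s) 1); last first.
    by apply: not_node; apply: sing; split=> //; apply: curve_point_in.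
  have [i] := nonsingular_gradient Cf f_gen (curve_point_in s) mult1.
  move: side0; rewrite /root /side hornerD hornerN !hornerM => /eqP side0.
  rewrite -horner_pullback.
  set a := (pullback f^`M(0)).[s] in grad_s side0.
  set b := (pullback f^`M(1)).[s] in grad_s side0.
  set x := X^`().[s] in grad_s side0; set y := Y^`().[s] in grad_s side0.
  have nrm : x ^+ 2 + y ^+ 2 != 0.
    by rewrite paddr_eq0 ?sqr_ge0 // !sqrf_eq0 negb_and; apply: immersion.
  have a0 : a = 0.
    apply: (mulIf nrm); rewrite mul0r.
    have -> : a * (x ^+ 2 + y ^+ 2) = (a * x + b * y) * x + (a * y - b * x) * y by ring.
    by rewrite grad_s side0; ring.
  have b0 : b = 0.
    apply: (mulIf nrm); rewrite mul0r.
    have -> : b * (x ^+ 2 + y ^+ 2) = (a * x + b * y) * y - (a * y - b * x) * x by ring.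
    by rewrite grad_s side0; ring.
  case: (unliftP ord0 i) => [k|] ->; last by rewrite -/a a0 eqxx.
  by rewrite (_ : lift ord0 k = 1) -/b ?b0 ?eqxx //; apply: val_inj; rewrite /= ord1.
have [df0 _] := node_hessian Cf f_gen nodeP.
by rewrite /root /side hornerD hornerN !hornerM !horner_pullback !df0 !mul0r subr0.
Qed.

Let hess (i j : 'I_2) s := (pullback f^`M(i)^`M(j)).[s].

Lemma deriv_side s : node C (curve_point alpha s) ->
  side^`().[s] = (hess 0 0 s * X^`().[s] + hess 0 1 s * Y^`().[s]) * Y^`().[s] -
                 (hess 0 1 s * X^`().[s] + hess 1 1 s * Y^`().[s]) * X^`().[s].
Proof.
move=> nodeP; have [df0 _] := node_hessian Cf f_gen nodeP.
rewrite /side derivB !derivM !deriv_pullback !(hornerD, hornerN, hornerM).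
by rewrite !horner_pullback !df0 /hess !horner_pullback (mderiv_comm 1 0); ring.
Qed.

(** This differentiates [pullback_gradient]; the terms with second derivatives of [alpha] carry the
    gradient of [f], which is zero at a node. *)
Lemma hess_velocity s : node C (curve_point alpha s) ->
  (hess 0 0 s * X^`().[s] + hess 0 1 s * Y^`().[s]) * X^`().[s] +
  (hess 0 1 s * X^`().[s] + hess 1 1 s * Y^`().[s]) * Y^`().[s] = 0.
Proof.
move=> nodeP; have [df0 _] := node_hessian Cf f_gen nodeP.
have := congr1 (fun p => p^`().[s]) pullback_gradient.
rewrite /= deriv0 horner0 derivD !derivM !deriv_pullback !(hornerD, hornerM).
rewrite !horner_pullback !df0 /hess !horner_pullback (mderiv_comm 1 0) => E.
by rewrite -[RHS]E; ring.
Qed.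

Lemma deriv_side_neq0 s : node C (curve_point alpha s) -> side^`().[s] != 0.
Proof.
move=> nodeP; rewrite deriv_side //; apply: nondegenerate_null_vector.
- have [_] := node_hessian Cf f_gen nodeP.
  by rewrite /hess !horner_pullback.
- exact: immersion.
- exact: hess_velocity.
Qed.

Lemma node_sides_opposite a b : a != b ->
  curve_point alpha a = curve_point alpha b -> node C (curve_point alpha a) ->
  side^`().[a] * side^`().[b] < 0.
Proof.
move=> ab Pab nodea; have nodeb : node C (curve_point alpha b) by rewrite -Pab.
have X_gt1 := node_nonvertical nodea.
have [K [F1 [G1 [u [w [c [K_monic XE YE c_neq0 cK]]]]]]] := common_factor Y X_gt1.
have Kab := common_factor_separates immersion K_monic XE YE c_neq0 cK ab.
have coord i : (alpha 0 i).[a] = (alpha 0 i).[b].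
  by have := congr1 (fun P : 'rV[R]_2 => P 0 i) Pab; rewrite !mxE.
have [A [fA AP]] := difference_quotient (alpha 0) f.
have one : lift ord0 ord0 = 1 :> 'I_2 by apply: val_inj.
have syz : A 0 * increment X + A 1 * increment Y = 0.
  move: fA; move/vanishes_onE: (Cf) => ->.
  by rewrite /increment rmorph0 polyC0 subrr !big_ord_recl big_ord0 addr0 one.
have [E [A0 A1]] := separated_syzygy X_gt1 K_monic XE YE c_neq0 cK syz.
have F1ab : eval2 a b F1 = 0.
  apply: (mulIf Kab); rewrite -eval2M -XE eval2_increment coord subrr.
  by rewrite mul0r.
have G1ab : eval2 a b G1 = 0.
  apply: (mulIf Kab); rewrite -eval2M -YE eval2_increment coord subrr.
  by rewrite mul0r.
have hessE i j : hess i j b = hess i j a.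
  by rewrite /hess !horner_pullback Pab.
(* As [G1] vanishes at (a, b), [D] maps A 0 = G1 E to D(G1) E(a, b) and the increment of Y to D(G1)
   K(a, b); likewise for [F1]. Twice D(A i) is a row of the Hessian applied to the displacement. *)
have key sigma tau D : tangent_derivation a b sigma tau D ->
    eval2 a b K * (hess 0 0 a * (sigma * X^`().[a] + tau * X^`().[b]) +
                   hess 0 1 a * (sigma * Y^`().[a] + tau * Y^`().[b])) =
    eval2 a b E *+ 2 * (sigma * Y^`().[a] - tau * Y^`().[b]) /\
    eval2 a b K * (hess 0 1 a * (sigma * X^`().[a] + tau * X^`().[b]) +
                   hess 1 1 a * (sigma * Y^`().[a] + tau * Y^`().[b])) =
    - (eval2 a b E *+ 2 * (sigma * X^`().[a] - tau * X^`().[b])).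
Proof.
  move=> Dt; have [DD DM Ds DT] := Dt.
  have DN h : D (- h) = - D h.
    have D0 : D 0 = 0 by rewrite -(polyC0 _) DT deriv0 horner0 mulr0.
    by apply/eqP; rewrite -addr_eq0 -DD addNr D0.
  have Dincr p : D (increment p) = sigma * p^`().[a] - tau * p^`().[b].
    by rewrite /increment DD DN Ds DT.
  have DX : D F1 * eval2 a b K = sigma * X^`().[a] - tau * X^`().[b].
    by rewrite -Dincr XE DM F1ab mul0r addr0.
  have DY : D G1 * eval2 a b K = sigma * Y^`().[a] - tau * Y^`().[b].
    by rewrite -Dincr YE DM G1ab mul0r addr0.
  have [_ /(_ _ _ _ Dt)] := AP a b coord 0.
  have [_ /(_ _ _ _ Dt)] := AP a b coord 1.
  rewrite !big_ord_recl !big_ord0 !addr0 !one (mderiv_comm 1 0) -!/(hess _ _ a).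
  move=> <- <-; rewrite A0 A1 DN !DM F1ab G1ab -DX -DY.
  by split; ring.
(* The direction s yields the velocity at a, the direction t that at b; the minus sign in p(s) -
   p(t) produces the opposite factor. *)
have [ka0 ka1] := key _ _ _ (tangent_derivation_s a b).
have [kb0 kb1] := key _ _ _ (tangent_derivation_t a b).
rewrite !deriv_side // !hessE.
apply: (opposite_slopes (k := eval2 a b K) (e := eval2 a b E *+ 2)) => //.
- by move: ka0; rewrite !(mul1r, mul0r, addr0, subr0).
- by move: ka1; rewrite !(mul1r, mul0r, addr0, subr0).
- by move: kb0; rewrite !(mul1r, mul0r, add0r, sub0r) mulrN.
- by move: kb1; rewrite !(mul1r, mul0r, add0r, sub0r) mulrN opprK.
- by rewrite -deriv_side // deriv_side_neq0.
- by rewrite -!hessE -deriv_side // deriv_side_neq0.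
Qed.

End Equation.
End NodalCurve.

(** * Parity of the two parameters of a node *)

Theorem proposition5p1 (R : realType) (C : set 'rV[R]_2)
    (alpha : 'rV[{poly R}]_2) (n : nat) (t : 'I_(2 * n) -> R)
    (nodal : nodal_parametrization C alpha)
    (card_nodes : ([set P | node C P] #= `I_n)%card)
    (t_incr : forall i j : 'I_(2 * n), (i < j)%N -> t i < t j)
    (t_nodes : curve_point alpha @^-1` [set P | node C P] = range t)
    (P : 'rV[R]_2) (P_node : node C P) (a b : 'I_(2 * n))
    (t_ab : curve_point alpha @^-1` [set P] = [set t a; t b]) :
  odd a != odd b.
Proof.
have t_inj : injective t.
  move=> i j tij; apply: val_inj; case: (ltngtP i j) => // /t_incr;
  by rewrite tij ltxx.
have t_node i : node C (curve_point alpha (t i)).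
  have : range t (t i) by exists i.
  by rewrite -t_nodes.
have [f Cf f_gen] := curve_equation nodal P_node.
have rootsE x : root (side alpha f) x <-> exists i, x = t i.
  rewrite (root_side nodal Cf f_gen).
  split=> [nodex|[i ->] //].
  have : range t x by rewrite -t_nodes.
  by move=> [i _ <-]; exists i.
have parity := alternating_simple_roots t_incr rootsE
  (fun i => deriv_side_neq0 nodal Cf f_gen (t_node i)).
(* Two parameters of one node give the derivative of [side] opposite signs, and by alternation the
   signs agree exactly when the parities do. *)
have opposite i j : i != j ->
    curve_point alpha (t i) = curve_point alpha (t j) -> odd i != odd j.
  move=> ij tij; rewrite -parity -leNgt ltW //.
  by apply: (node_sides_opposite nodal Cf f_gen) => //; rewrite (inj_eq t_inj).
apply: (opposite); last first.
  have [ta tb] : [set t a; t b] (t a) /\ [set t a; t b] (t b) by split; [left|right].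
  by move: ta tb; rewrite -t_ab /= => -> ->.
(* If a = b, the node P has a single parameter. Every other node has at most two, so fewer than 2n
   parameters would lie over the n nodes. *)
apply/eqP => ab; have /card_set_bijP[phi [phi_fun phi_inj _]] := card_nodes.
pose psi i := Ordinal (phi_fun _ (t_node i)).
have psiE i j : psi i = psi j -> curve_point alpha (t i) = curve_point alpha (t j).
  by move=> /(congr1 val) /= /phi_inj; apply; apply/mem_set; apply: t_node.
suff : (2 * n < 2 * n)%N by rewrite ltnn.
apply: (@card_lt_of_small_fibers _ _ psi (psi a)) => [k|].
  (* Parity is injective on a fibre by [opposite], so a fibre has at most two elements. *)
  rewrite -(@card_in_imset _ _ (fun i : 'I_(2 * n) => odd i)).
    by rewrite (leq_trans (max_card _)) ?card_bool.
  move=> i j; rewrite !inE => /eqP ik /eqP jk oddij; apply/eqP; apply: contraT.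
  by move=> ij; have := opposite _ _ ij (psiE _ _ (etrans ik (esym jk))); rewrite oddij eqxx.
apply: (@leq_trans #|[set a]%SET|); last by rewrite cards1.
apply/subset_leq_card/fintype.subsetP => i; rewrite !inE => /eqP/psiE tia; apply/eqP/t_inj.
have : [set t a; t b] (t i).
  rewrite -t_ab /= tia.
  have : [set t a; t b] (t a) by left.
  by rewrite -t_ab.
by rewrite -ab => -[].
Qed.
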